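(* Let $(M\xrightarrow{\partial}N,\cdot,\{-,-\})$ be a perfect braided crossed module of Lie $K$-algebras. Let $\Phi=(\Phi_1,\Phi_2)$, where $\Phi_1\colon N\otimes N\to M$ is the Lie homomorphism determined by $n\otimes n'\mapsto\{n,n'\}$ and $\Phi_2\colon N\otimes N\to N$ is the Lie homomorphism determined by $n\otimes n'\mapsto[n,n']$. Then $$(N\otimes N\xrightarrow{\mathrm{Id}_{N\otimes N}}N\otimes N,[-,-],[-,-])\xrightarrow{\ \Phi\ }(M\xrightarrow{\partial}N,\cdot,\{-,-\})$$ is the universal central extension of $(M\xrightarrow{\partial}N,\cdot,\{-,-\})$ in the category of braided crossed modules of Lie $K$-algebras.
   Context: $K$ is a fixed field; all Lie algebras and Lie homomorphisms are over $K$. A crossed module of Lie algebras $(M\xrightarrow{\partial}N,\cdot)$ consists of a Lie action of $N$ on $M$, i.e. a $K$-bilinear map $\cdot\colon N\times M\to M$ with $[n,n']\cdot m=n\cdot(n'\cdot m)-n'\cdot(n\cdot m)$ and $n\cdot[m,m']=[n\cdot m,m']+[m,n\cdot m']$, and a Lie homomorphism $\partial\colon M\to N$ with $\partial(n\cdot m)=[n,\partial(m)]$ and $\partial(m)\cdot m'=[m,m']$. A braiding on it is a $K$-bilinear map $\{-,-\}\colon N\times N\to M$ such that, for all $m,m'\in M$, $n,n',n''\in N$: $\partial\{n,n'\}=[n,n']$; $\{\partial m,\partial m'\}=[m,m']$; $\{\partial m,n\}=-n\cdot m$; $\{n,\partial m\}=n\cdot m$; $\{n,[n',n'']\}=\{[n,n'],n''\}-\{[n,n''],n'\}$;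 $\{[n,n'],n''\}=\{n,[n',n'']\}-\{n',[n,n'']\}$. Then $(M\xrightarrow{\partial}N,\cdot,\{-,-\})$ is a braided crossed module. For any Lie algebra $P$, $(P\xrightarrow{\mathrm{Id}_P}P,[-,-],[-,-])$ denotes the braided crossed module given by the identity map, the adjoint action and the braiding $(p,p')\mapsto[p,p']$. A morphism of braided crossed modules from $(M\xrightarrow{\partial}N,\cdot,\{-,-\})$ to $(L\xrightarrow{\delta}H,*,\langle-,-\rangle)$ is a pair of Lie homomorphisms $f_1\colon M\to L$, $f_2\colon N\to H$ with $f_1(n\cdot m)=f_2(n)*f_1(m)$, $\delta\circ f_1=f_2\circ\partial$ and $f_1(\{n,n'\})=\langle f_2(n),f_2(n')\rangle$. For a braided crossed module $(M\xrightarrow{\partial}N,\cdot,\{-,-\})$ of Lie $K$-algebras put $M^N=\{m\in M\mid n\cdot m=0\ \forall n\in N\}$ and $Z_B(N)=\{n\in N\mid \{n,n'\}=0=\{n',n\}\ \forall n'\in N\}$. An extension is a morphism $(f_1,f_2)$ with $f_1,f_2$ surjective; an extension with domain $(M\xrightarrow{\partial}N,\cdot,\{-,-\})$ is central if $\ker(f_1)\subset M^N$ and $\ker(f_2)\subset Z_B(N)$. A central extension $u\colon\mathcal{U}\to\mathcal{X}$ is universal if for every central extension $f\colon\mathcal{Z}\to\mathcal{X}$ there is a unique morphism of braided crossed modules $h\colon\mathcal{U}\to\mathcal{Z}$ with $u=f\circ h$. For a braided crossed module $(M\xrightarrow{\partial}N,\cdot,\{-,-\})$, let $B_N(M)$ be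 the Lie subalgebra of $M$ generated by all $\{n,n'\}$, $n,n'\in N$. The braided crossed module is perfect if $M=B_N(M)$ and $N=[N,N]$. The non-abelian tensor product $N\otimes N$ (with $N$ acting on itself by the adjoint action) is the Lie $K$-algebra generated by symbols $n\otimes n'$ ($n,n'\in N$) subject to: $K$-bilinearity of $(n,n')\mapsto n\otimes n'$; $[n_1,n_2]\otimes n_3=n_1\otimes[n_2,n_3]-n_2\otimes[n_1,n_3]$; $n_1\otimes[n_2,n_3]=[n_3,n_1]\otimes n_2-[n_2,n_1]\otimes n_3$; $[n_1\otimes n_2,n_3\otimes n_4]=[n_1,n_2]\otimes[n_3,n_4]$. *)

(* Defs.v *)
From HB Require Import structures.
From mathcomp Require Import all_boot all_algebra.
From mathcomp Require Import generic_quotient.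
From mathcomp Require Import boolp classical_sets.

Set Implicit Arguments.
Unset Strict Implicit.
Unset Printing Implicit Defensive.

Import GRing.Theory.

Local Open Scope quotient_scope.
Local Open Scope ring_scope.
Local Open Scope classical_set_scope.

Reserved Notation "{[ x , y ]}" (at level 0, x, y at level 99,
  format "{[ x ,  y ]}").

(* The bracket is alternating ([x, x] = 0), so that characteristic 2 is
   covered. *)
HB.mixin Record Lmodule_isLie (K : fieldType) (L : Type)
    of GRing.Lmodule K L := {
  lie : L -> L -> L;
  lie_bilinear : bilinear_for *:%R *:%R lie;
  liexx : forall x, lie x x = 0;
  lie_jacobi : forall x y z,
    lie x (lie y z) + lie y (lie z x) + lie z (lie x y) = 0
}.

#[short(type="lieAlgType")]
HB.structure Definition LieAlgebra (K : fieldType) :=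
  {L of Lmodule_isLie K L & GRing.Lmodule K L}.

Notation "{[ x , y ]}" := (lie x y) : ring_scope.

HB.mixin Record isLieMorphism (K : fieldType) (L M : lieAlgType K)
    (f : L -> M) := {
  lie_morph : forall x y, f {[x, y]} = {[f x, f y]}
}.

#[short(type="lieMorphism")]
HB.structure Definition LieMorphism (K : fieldType) (L M : lieAlgType K) :=
  {f of isLieMorphism K L M f & @GRing.Linear K L M *:%R f}.

Notation "{ 'lie' L -> M }" := (lieMorphism L%type M%type)
  (at level 0, L at level 98, M at level 99,
   format "{ 'lie'  L  ->  M }") : type_scope.

HB.instance Definition _ (K : fieldType) (L : lieAlgType K) :=
  isLieMorphism.Build K L L idfun (fun _ _ => erefl).

Definition subspace (K : fieldType) (L : lieAlgType K) (A : set L) : Prop :=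
  A 0 /\ (forall (a : K) x y, A x -> A y -> A (a *: x + y)).

Definition lie_subalgebra (K : fieldType) (L : lieAlgType K) (A : set L) :
    Prop :=
  subspace A /\ (forall x y, A x -> A y -> A {[x, y]}).

Definition derived (K : fieldType) (L : lieAlgType K) : set L :=
  smallest (@subspace K L) [set {[x, y]} | x in [set: L] & y in [set: L]].

Arguments derived {K} L _.

Inductive lie_term (K X : Type) : Type :=
| LGen of X
| LZero
| LAdd of lie_term K X & lie_term K X
| LScale of K & lie_term K X
| LBracket of lie_term K X & lie_term K X.

Arguments LGen {K X}.
Arguments LZero {K X}.

Definition LSub (K : fieldType) (X : Type) (s t : lie_term K X) :=
  LAdd s (LScale (-1) t).

(* The least congruence containing [R] and the Lie algebra axioms. *)
Inductive lie_cong (K : fieldType) (X : Type)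
    (R : lie_term K X -> lie_term K X -> Prop) :
    lie_term K X -> lie_term K X -> Prop :=
| LC_rel s t : R s t -> lie_cong R s t
| LC_refl s : lie_cong R s s
| LC_sym s t : lie_cong R s t -> lie_cong R t s
| LC_trans s t u : lie_cong R s t -> lie_cong R t u -> lie_cong R s u
| LC_add s s' t t' : lie_cong R s s' -> lie_cong R t t' ->
    lie_cong R (LAdd s t) (LAdd s' t')
| LC_scale a s s' : lie_cong R s s' -> lie_cong R (LScale a s) (LScale a s')
| LC_bracket s s' t t' : lie_cong R s s' -> lie_cong R t t' ->
    lie_cong R (LBracket s t) (LBracket s' t')
| LC_addA s t u : lie_cong R (LAdd s (LAdd t u)) (LAdd (LAdd s t) u)
| LC_addC s t : lie_cong R (LAdd s t) (LAdd t s)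
| LC_add0 s : lie_cong R (LAdd LZero s) s
| LC_addN s : lie_cong R (LAdd (LScale (-1) s) s) LZero
| LC_scaleA a b s :
    lie_cong R (LScale a (LScale b s)) (LScale (a * b) s)
| LC_scale1 s : lie_cong R (LScale 1 s) s
| LC_scaleDr a s t :
    lie_cong R (LScale a (LAdd s t)) (LAdd (LScale a s) (LScale a t))
| LC_scaleDl a b s :
    lie_cong R (LScale (a + b) s) (LAdd (LScale a s) (LScale b s))
| LC_bracketl a s t u : lie_cong R (LBracket (LAdd (LScale a s) t) u)
    (LAdd (LScale a (LBracket s u)) (LBracket t u))
| LC_bracketr a s t u : lie_cong R (LBracket u (LAdd (LScale a s) t))
    (LAdd (LScale a (LBracket u s)) (LBracket u t))
| LC_bracketxx s : lie_cong R (LBracket s s) LZero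
| LC_jacobi s t u : lie_cong R
    (LAdd (LAdd (LBracket s (LBracket t u)) (LBracket t (LBracket u s)))
          (LBracket u (LBracket s t))) LZero.

HB.instance Definition _ (K X : Type) := gen_eqMixin (lie_term K X).
HB.instance Definition _ (K X : Type) := gen_choiceMixin (lie_term K X).

Section Presentation.
Variables (K : fieldType) (X : Type) (R : lie_term K X -> lie_term K X -> Prop).

Definition lie_congb : rel (lie_term K X) := fun s t => `[< lie_cong R s t >].

Lemma lie_congb_equiv : equiv_class_of lie_congb.
Proof.
split=> [s|s t|t s u].
- exact/asboolP/LC_refl.
- by apply/asboolP/asboolP; exact: LC_sym.
- by move=> /asboolP st /asboolP tu; apply/asboolP/(LC_trans st tu).
Qed.

Canonical lie_cong_equiv := EquivRelPack lie_congb_equiv.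

Definition presented := {eq_quot lie_congb}.

HB.instance Definition _ := Choice.on presented.
HB.instance Definition _ := Quotient.on presented.

Definition pclass (t : lie_term K X) : presented := \pi_presented t.

Lemma pclassP s t : pclass s = pclass t <-> lie_cong R s t.
Proof.
rewrite (rwP (asboolP (lie_cong R s t))).
exact: rwP (@eqquotP _ lie_cong_equiv presented s t).
Qed.

Definition padd (x y : presented) := pclass (LAdd (repr x) (repr y)).
Definition pscale (a : K) (x : presented) := pclass (LScale a (repr x)).
Definition plie (x y : presented) := pclass (LBracket (repr x) (repr y)).
Definition popp := pscale (-1).

Lemma pclass_repr x : pclass (repr x) = x.
Proof. exact: reprK. Qed.

Lemma repr_pclass s : lie_cong R (repr (pclass s)) s.
Proof. by apply/pclassP; rewrite pclass_repr. Qed.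

Lemma pclass_add s t : padd (pclass s) (pclass t) = pclass (LAdd s t).
Proof. by apply/pclassP/LC_add; exact: repr_pclass. Qed.

Lemma pclass_scale a s : pscale a (pclass s) = pclass (LScale a s).
Proof. by apply/pclassP/LC_scale; exact: repr_pclass. Qed.

Lemma pclass_bracket s t : plie (pclass s) (pclass t) = pclass (LBracket s t).
Proof. by apply/pclassP/LC_bracket; exact: repr_pclass. Qed.

Let pE := (pclass_add, pclass_scale, pclass_bracket).

Lemma pclass_ind (P : presented -> Prop) :
  (forall s, P (pclass s)) -> forall x, P x.
Proof. by move=> Ps x; rewrite -(pclass_repr x). Qed.

Fact paddA : associative padd.
Proof.
elim/pclass_ind=> s; elim/pclass_ind=> t; elim/pclass_ind=> u.
by rewrite !pE; apply/pclassP/LC_addA.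
Qed.

Fact paddC : commutative padd.
Proof.
elim/pclass_ind=> s; elim/pclass_ind=> t.
by rewrite !pE; apply/pclassP/LC_addC.
Qed.

Fact padd0 : left_id (pclass LZero) padd.
Proof. by elim/pclass_ind=> s; rewrite !pE; apply/pclassP/LC_add0. Qed.

Fact paddN : left_inverse (pclass LZero) popp padd.
Proof. by elim/pclass_ind=> s; rewrite /popp !pE; apply/pclassP/LC_addN. Qed.

HB.instance Definition _ :=
  GRing.isZmodule.Build presented paddA paddC padd0 paddN.

Fact pscaleA a b x : pscale a (pscale b x) = pscale (a * b) x.
Proof. by elim/pclass_ind: x => s; rewrite !pE; apply/pclassP/LC_scaleA. Qed.

Fact pscale1 : left_id 1 pscale.
Proof. by elim/pclass_ind=> s; rewrite !pE; apply/pclassP/LC_scale1. Qed.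

Fact pscaleDr : right_distributive pscale +%R.
Proof.
move=> a; elim/pclass_ind=> s; elim/pclass_ind=> t.
by rewrite /+%R /= !pE; apply/pclassP/LC_scaleDr.
Qed.

Fact pscaleDl x : {morph pscale^~ x : a b / a + b}.
Proof.
move=> a b; elim/pclass_ind: x => s.
by rewrite [in RHS]/+%R /= !pE; apply/pclassP/LC_scaleDl.
Qed.

HB.instance Definition _ :=
  GRing.Zmodule_isLmodule.Build K presented pscaleA pscale1 pscaleDr pscaleDl.

Lemma pclassD s t : pclass (LAdd s t) = pclass s + pclass t.
Proof. by rewrite -pclass_add. Qed.

Lemma pclassZ a s : pclass (LScale a s) = a *: pclass s.
Proof. by rewrite -pclass_scale. Qed.

Fact plie_bilinear : bilinear_for *:%R *:%R plie.
Proof.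
have pclass_lin a s t :
    pclass (LAdd (LScale a s) t) = a *: pclass s + pclass t.
  by rewrite pclassD pclassZ.
split=> x a; elim/pclass_ind: x => u; elim/pclass_ind=> s;
  elim/pclass_ind=> t; rewrite -pclass_lin !pclass_bracket.
- by rewrite -[RHS]pclass_lin; apply/pclassP/LC_bracketl.
- by rewrite -[RHS]pclass_lin; apply/pclassP/LC_bracketr.
Qed.

Fact pliexx x : plie x x = 0.
Proof.
by elim/pclass_ind: x => s; rewrite pclass_bracket; apply/pclassP/LC_bracketxx.
Qed.

Fact plie_jacobi x y z :
  plie x (plie y z) + plie y (plie z x) + plie z (plie x y) = 0.
Proof.
elim/pclass_ind: x => s; elim/pclass_ind: y => t; elim/pclass_ind: z => u.
by rewrite !pclass_bracket -!pclassD; apply/pclassP/LC_jacobi.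
Qed.

HB.instance Definition _ :=
  Lmodule_isLie.Build K presented plie_bilinear pliexx plie_jacobi.

End Presentation.

Section Tensor.
Variables (K : fieldType) (N : lieAlgType K).

Let g (n n' : N) : lie_term K (N * N) := LGen (n, n').

Inductive tensor_rel : lie_term K (N * N) -> lie_term K (N * N) -> Prop :=
| TR_linl a n1 n2 n :
    tensor_rel (g (a *: n1 + n2) n) (LAdd (LScale a (g n1 n)) (g n2 n))
| TR_linr a n1 n2 n :
    tensor_rel (g n (a *: n1 + n2)) (LAdd (LScale a (g n n1)) (g n n2))
| TR_liel n1 n2 n3 :
    tensor_rel (g {[n1, n2]} n3) (LSub (g n1 {[n2, n3]}) (g n2 {[n1, n3]}))
| TR_lier n1 n2 n3 :
    tensor_rel (g n1 {[n2, n3]}) (LSub (g {[n3, n1]} n2) (g {[n2, n1]} n3))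
| TR_bracket n1 n2 n3 n4 :
    tensor_rel (LBracket (g n1 n2) (g n3 n4)) (g {[n1, n2]} {[n3, n4]}).

(* The non-abelian tensor product of [N] with itself, for the adjoint action. *)
Definition tensor : lieAlgType K := presented tensor_rel.

Definition tens (n n' : N) : tensor := pclass tensor_rel (g n n').

(* [phi] is the Lie homomorphism determined by [n (x) n' |-> f n n']. *)
Definition determined_by (L : lieAlgType K) (f : N -> N -> L)
    (phi : {lie tensor -> L}) : Prop :=
  (forall n n', phi (tens n n') = f n n') /\
  (forall psi : {lie tensor -> L},
     (forall n n', psi (tens n n') = f n n') -> psi =1 phi).

End Tensor.

Record crossedModule (K : fieldType) := CrossedModule {
  xmM : lieAlgType K;
  xmN : lieAlgType K;
  xmd : {lie xmM -> xmN};
  xmact : xmN -> xmM -> xmM;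
  xmact_bilinear : bilinear_for *:%R *:%R xmact;
  xmact_liel : forall n n' m,
    xmact {[n, n']} m = xmact n (xmact n' m) - xmact n' (xmact n m);
  xmact_lier : forall n m m',
    xmact n {[m, m']} = {[xmact n m, m']} + {[m, xmact n m']};
  xmd_act : forall n m, xmd (xmact n m) = {[n, xmd m]};
  xm_peiffer : forall m m', xmact (xmd m) m' = {[m, m']}
}.

Record braidedCrossedModule (K : fieldType) := BraidedCrossedModule {
  bxm_xm :> crossedModule K;
  braid : xmN bxm_xm -> xmN bxm_xm -> xmM bxm_xm;
  braid_bilinear : bilinear_for *:%R *:%R braid;
  xmd_braid : forall n n', xmd bxm_xm (braid n n') = {[n, n']};
  braid_dd : forall m m', braid (xmd bxm_xm m) (xmd bxm_xm m') = {[m, m']};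
  braid_dl : forall m n, braid (xmd bxm_xm m) n = - xmact n m;
  braid_dr : forall n m, braid n (xmd bxm_xm m) = xmact n m;
  braid_lier : forall n n' n'',
    braid n {[n', n'']} = braid {[n, n']} n'' - braid {[n, n'']} n';
  braid_liel : forall n n' n'',
    braid {[n, n']} n'' = braid n {[n', n'']} - braid n' {[n, n'']}
}.

Section IdBraided.
Variables (K : fieldType) (P : lieAlgType K).
Implicit Types x y z : P.

Let lieDl x y z : {[x + y, z]} = {[x, z]} + {[y, z]}.
Proof.
by have := (@lie_bilinear K P).1 z 1 x y; rewrite /= !scale1r.
Qed.

Let lieDr x y z : {[z, x + y]} = {[z, x]} + {[z, y]}.
Proof.
by have := (@lie_bilinear K P).2 z 1 x y; rewrite /= !scale1r.
Qed.

Let lieC x y : {[x, y]} = - {[y, x]}.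
Proof.
apply/eqP; rewrite -addr_eq0.
by have := liexx (x + y); rewrite lieDl !lieDr !liexx add0r addr0 => ->.
Qed.

Let lieNr x y : {[x, - y]} = - {[x, y]}.
Proof.
apply/eqP; rewrite -addr_eq0 -lieDr addNr.
by apply/eqP/(addrI {[x, 0]}); rewrite -lieDr !addr0.
Qed.

Let lie_liel x y z : {[{[x, y]}, z]} = {[x, {[y, z]}]} - {[y, {[x, z]}]}.
Proof.
rewrite (lieC {[x, y]}) -lieNr -(lieNr y) -(lieC z x).
have /eqP := lie_jacobi x y z; rewrite addr_eq0 => /eqP ->.
by rewrite lieNr.
Qed.

Let lie_lier x y z : {[x, {[y, z]}]} = {[{[x, y]}, z]} + {[y, {[x, z]}]}.
Proof. by rewrite lie_liel subrK. Qed.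

Let lie_lier' x y z : {[x, {[y, z]}]} = {[{[x, y]}, z]} - {[{[x, z]}, y]}.
Proof. by rewrite lie_lier (lieC y). Qed.

Definition id_crossedModule : crossedModule K :=
  @CrossedModule K P P idfun lie lie_bilinear lie_liel lie_lier
    (fun _ _ => erefl) (fun _ _ => erefl).

Definition id_braidedCrossedModule : braidedCrossedModule K :=
  @BraidedCrossedModule K id_crossedModule lie lie_bilinear
    (fun _ _ => erefl) (fun _ _ => erefl) lieC (fun _ _ => erefl)
    lie_lier' lie_liel.

End IdBraided.

Record is_bxm_morphism (K : fieldType) (X Y : braidedCrossedModule K)
    (f1 : {lie xmM X -> xmM Y}) (f2 : {lie xmN X -> xmN Y}) : Prop :=
  IsBxmMorphism {
  bxm_morph_act : forall n m, f1 (xmact n m) = xmact (f2 n) (f1 m);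
  bxm_morph_d : forall m, xmd Y (f1 m) = f2 (xmd X m);
  bxm_morph_braid : forall n n', f1 (braid n n') = braid (f2 n) (f2 n')
}.

Record bxmMorphism (K : fieldType) (X Y : braidedCrossedModule K) :=
  BxmMorphism {
  bxm1 : {lie xmM X -> xmM Y};
  bxm2 : {lie xmN X -> xmN Y};
  bxmP : is_bxm_morphism bxm1 bxm2
}.

(* [M^N] *)
Definition act_invariants (K : fieldType) (X : braidedCrossedModule K) :
    set (xmM X) :=
  [set m | forall n : xmN X, xmact n m = 0].

Arguments act_invariants {K} X _.

(* [Z_B(N)] *)
Definition braid_center (K : fieldType) (X : braidedCrossedModule K) :
    set (xmN X) :=
  [set n | forall n' : xmN X, braid n n' = 0 /\ braid n' n = 0].

Arguments braid_center {K} X _.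

(* [B_N(M)] *)
Definition braid_subalgebra (K : fieldType) (X : braidedCrossedModule K) :
    set (xmM X) :=
  smallest (@lie_subalgebra K (xmM X))
    [set braid n n' | n in [set: xmN X] & n' in [set: xmN X]].

Arguments braid_subalgebra {K} X _.

Definition perfect (K : fieldType) (X : braidedCrossedModule K) : Prop :=
  braid_subalgebra X = [set: xmM X] /\ derived (xmN X) = [set: xmN X].

Definition extension (K : fieldType) (X Y : braidedCrossedModule K)
    (f : bxmMorphism X Y) : Prop :=
  (forall y, exists x, bxm1 f x = y) /\ (forall y, exists x, bxm2 f x = y).

Definition central_extension (K : fieldType) (X Y : braidedCrossedModule K)
    (f : bxmMorphism X Y) : Prop :=
  [/\ extension f,
      [set m | bxm1 f m = 0] `<=` act_invariants X &
      [set n | bxm2 f n = 0] `<=` braid_center X].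

(* [u = f \o h] *)
Definition factors_through (K : fieldType) (U X Z : braidedCrossedModule K)
    (u : bxmMorphism U X) (f : bxmMorphism Z X) (h : bxmMorphism U Z) : Prop :=
  bxm1 u =1 bxm1 f \o bxm1 h /\ bxm2 u =1 bxm2 f \o bxm2 h.

Definition universal_central_extension (K : fieldType)
    (U X : braidedCrossedModule K) (u : bxmMorphism U X) : Prop :=
  central_extension u /\
  forall (Z : braidedCrossedModule K) (f : bxmMorphism Z X),
    central_extension f ->
    exists h : bxmMorphism U Z, factors_through u f h /\
      forall h' : bxmMorphism U Z, factors_through u f h' ->
        bxm1 h' =1 bxm1 h /\ bxm2 h' =1 bxm2 h.

(* Main.v *)
From HB Require Import structures.
Require Import Defs.
From mathcomp Require Import all_boot all_algebra.
From mathcomp Require Import boolp classical_sets.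

Set Implicit Arguments.
Unset Strict Implicit.
Unset Printing Implicit Defensive.

Import GRing.Theory.

Local Open Scope ring_scope.
Local Open Scope classical_set_scope.

(** For every braided crossed module, a Lie homomorphism [h : P -> M] is the
    same thing as the morphism [(h, d o h)] out of the identity braided crossed
    module on [P].  Let [Phi2 (n (x) n') = [n, n']].  Since the tensor product
    is linearly spanned by the [n (x) n'], its defining relation on brackets
    gives [[t, s] = Phi2 t (x) Phi2 s]; hence [ker Phi2] is central, and, when
    [N] is perfect, every generator [n (x) n'] is a bracket.  The braiding of a
    central extension [f] of [X] only depends on the images under [f2], so it
    descends to [N x N] and satisfies the relations of the tensor product: this
    is the lift of [Phi].  For the same reason two lifts agree on brackets,
    hence on generators. *)

(** * Bilinear maps and antisymmetry of the bracket *)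

Lemma bilinear_forDl (K : fieldType) (U V W : lmodType K) (b : U -> V -> W)
    (bb : bilinear_for *:%R *:%R b) x y z : b (x + y) z = b x z + b y z.
Proof. by have := bb.1 z 1 x y; rewrite /= !scale1r. Qed.

Lemma bilinear_forDr (K : fieldType) (U V W : lmodType K) (b : U -> V -> W)
    (bb : bilinear_for *:%R *:%R b) x y z : b z (x + y) = b z x + b z y.
Proof. by have := bb.2 z 1 x y; rewrite /= !scale1r. Qed.

Lemma bilinear_for0l (K : fieldType) (U V W : lmodType K) (b : U -> V -> W)
    (bb : bilinear_for *:%R *:%R b) z : b 0 z = 0.
Proof. by apply: (addrI (b 0 z)); rewrite -(bilinear_forDl bb) !addr0. Qed.

Lemma bilinear_for0r (K : fieldType) (U V W : lmodType K) (b : U -> V -> W)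
    (bb : bilinear_for *:%R *:%R b) z : b z 0 = 0.
Proof. by apply: (addrI (b z 0)); rewrite -(bilinear_forDr bb) !addr0. Qed.

Lemma bilinear_forZl (K : fieldType) (U V W : lmodType K) (b : U -> V -> W)
    (bb : bilinear_for *:%R *:%R b) a x z : b (a *: x) z = a *: b x z.
Proof.
by have := bb.1 z a x 0; rewrite /= !addr0 (bilinear_for0l bb) addr0.
Qed.

Lemma bilinear_forZr (K : fieldType) (U V W : lmodType K) (b : U -> V -> W)
    (bb : bilinear_for *:%R *:%R b) a x z : b z (a *: x) = a *: b z x.
Proof.
by have := bb.2 z a x 0; rewrite /= !addr0 (bilinear_for0r bb) addr0.
Qed.

Lemma bilinear_forNl (K : fieldType) (U V W : lmodType K) (b : U -> V -> W)
    (bb : bilinear_for *:%R *:%R b) x z : b (- x) z = - b x z.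
Proof. by rewrite -scaleN1r (bilinear_forZl bb) scaleN1r. Qed.

Lemma bilinear_forBl (K : fieldType) (U V W : lmodType K) (b : U -> V -> W)
    (bb : bilinear_for *:%R *:%R b) x y z : b (x - y) z = b x z - b y z.
Proof. by rewrite (bilinear_forDl bb) (bilinear_forNl bb). Qed.

Lemma bilinear_forBr (K : fieldType) (U V W : lmodType K) (b : U -> V -> W)
    (bb : bilinear_for *:%R *:%R b) x y z : b z (x - y) = b z x - b z y.
Proof.
by rewrite (bilinear_forDr bb) -scaleN1r (bilinear_forZr bb) scaleN1r.
Qed.

Lemma lieC (K : fieldType) (L : lieAlgType K) (x y : L) :
  {[x, y]} = - {[y, x]}.
Proof.
apply/eqP; rewrite -addr_eq0; have bb := @lie_bilinear K L.
by have := liexx (x + y);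
  rewrite (bilinear_forDl bb) !(bilinear_forDr bb) !liexx add0r addr0 => ->.
Qed.

Lemma comp_lie_morph (K : fieldType) (L M P : lieAlgType K)
    (g : {lie M -> P}) (f : {lie L -> M}) (x y : L) :
  (g \o f) {[x, y]} = {[(g \o f) x, (g \o f) y]}.
Proof. by rewrite /= !lie_morph. Qed.

HB.instance Definition _ (K : fieldType) (L M P : lieAlgType K)
    (g : {lie M -> P}) (f : {lie L -> M}) :=
  isLieMorphism.Build K L P (g \o f) (comp_lie_morph g f).

(** * Homomorphisms out of a presented Lie algebra *)

Fixpoint lie_eval (K : fieldType) (X : Type) (L : lieAlgType K) (f : X -> L)
    (t : lie_term K X) : L :=
  match t with
  | LGen x => f x
  | LZero => 0
  | LAdd s t => lie_eval f s + lie_eval f t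
  | LScale a s => a *: lie_eval f s
  | LBracket s t => {[lie_eval f s, lie_eval f t]}
  end.

Definition respects (K : fieldType) (X : Type) (L : lieAlgType K) (f : X -> L)
    (R : lie_term K X -> lie_term K X -> Prop) : Prop :=
  forall s t, R s t -> lie_eval f s = lie_eval f t.

(** Apart from [LC_rel], which is [fR], each rule of [lie_cong] is a property of equality or an
    identity valid in every Lie algebra. *)
Lemma lie_eval_cong (K : fieldType) (X : Type) (L : lieAlgType K) (f : X -> L)
    (R : lie_term K X -> lie_term K X -> Prop) (fR : respects f R) s t :
  lie_cong R s t -> lie_eval f s = lie_eval f t.
Proof.
elim=> //=.
- by move=> {}s {}t u _ -> _.
- by move=> {}s s' {}t t' _ -> _ ->.
- by move=> a {}s s' _ ->.
- by move=> {}s s' {}t t' _ -> _ ->.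
- by move=> *; rewrite addrA.
- by move=> *; rewrite addrC.
- by move=> *; rewrite add0r.
- by move=> *; rewrite scaleN1r addNr.
- by move=> *; rewrite scalerA.
- by move=> *; rewrite scale1r.
- by move=> *; rewrite scalerDr.
- by move=> *; rewrite scalerDl.
- by move=> a {}s {}t u; exact: (@lie_bilinear K L).1.
- by move=> a {}s {}t u; exact: (@lie_bilinear K L).2.
- by move=> *; exact: liexx.
- by move=> *; exact: lie_jacobi.
Qed.

Lemma pclass_lie (K : fieldType) (X : Type)
    (R : lie_term K X -> lie_term K X -> Prop) s t :
  pclass R (LBracket s t) = {[pclass R s, pclass R t]}.
Proof. by rewrite -pclass_bracket. Qed.

Definition presented_lift (K : fieldType) (X : Type) (L : lieAlgType K)
    (f : X -> L) (R : lie_term K X -> lie_term K X -> Prop)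
    (fR : respects f R) (x : presented R) : L := lie_eval f (repr x).

Lemma presented_lift_pclass (K : fieldType) (X : Type) (L : lieAlgType K)
    (f : X -> L) (R : lie_term K X -> lie_term K X -> Prop)
    (fR : respects f R) t : presented_lift fR (pclass R t) = lie_eval f t.
Proof. exact/(lie_eval_cong fR)/repr_pclass. Qed.

Lemma presented_lift_linear (K : fieldType) (X : Type) (L : lieAlgType K)
    (f : X -> L) (R : lie_term K X -> lie_term K X -> Prop)
    (fR : respects f R) : linear (presented_lift fR).
Proof.
move=> a; elim/pclass_ind=> s; elim/pclass_ind=> t.
by rewrite -pclassZ -pclassD !presented_lift_pclass.
Qed.

HB.instance Definition _ (K : fieldType) (X : Type) (L : lieAlgType K)
    (f : X -> L) (R : lie_term K X -> lie_term K X -> Prop)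
    (fR : respects f R) :=
  GRing.isLinear.Build K (presented R) L _ (presented_lift fR)
    (presented_lift_linear fR).

Lemma presented_lift_lie (K : fieldType) (X : Type) (L : lieAlgType K)
    (f : X -> L) (R : lie_term K X -> lie_term K X -> Prop)
    (fR : respects f R) (x y : presented R) :
  presented_lift fR {[x, y]} = {[presented_lift fR x, presented_lift fR y]}.
Proof.
elim/pclass_ind: x => s; elim/pclass_ind: y => t.
by rewrite -pclass_lie !presented_lift_pclass.
Qed.

HB.instance Definition _ (K : fieldType) (X : Type) (L : lieAlgType K)
    (f : X -> L) (R : lie_term K X -> lie_term K X -> Prop)
    (fR : respects f R) :=
  isLieMorphism.Build K (presented R) L (presented_lift fR)
    (presented_lift_lie fR).

Lemma presented_hom_ext (K : fieldType) (X : Type) (L : lieAlgType K)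
    (R : lie_term K X -> lie_term K X -> Prop)
    (phi psi : {lie presented R -> L}) :
  (forall x, phi (pclass R (LGen x)) = psi (pclass R (LGen x))) -> phi =1 psi.
Proof.
move=> eq_gen; elim/pclass_ind; elim=> //=.
- by rewrite (_ : pclass R LZero = 0) // !linear0.
- by move=> s IHs t IHt; rewrite pclassD !linearD /= IHs IHt.
- by move=> a s IHs; rewrite pclassZ !linearZ /= IHs.
- by move=> s IHs t IHt; rewrite pclass_lie !lie_morph IHs IHt.
Qed.

(** * The non-abelian tensor product *)

Lemma tensor_hom_ext (K : fieldType) (N L : lieAlgType K)
    (phi psi : {lie tensor N -> L}) :
  (forall n n', phi (tens n n') = psi (tens n n')) -> phi =1 psi.
Proof. by move=> eq_gen; apply: presented_hom_ext => -[n n']; exact: eq_gen. Qed.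

Lemma tens_bilinear (K : fieldType) (N : lieAlgType K) :
  bilinear_for *:%R *:%R (@tens K N).
Proof.
by split=> n a n1 n2; rewrite -[RHS]/(a *: pclass _ _ + pclass _ _) -pclassZ
  -pclassD; apply/pclassP/LC_rel; constructor.
Qed.

Lemma lie_tens (K : fieldType) (N : lieAlgType K) (n1 n2 n3 n4 : N) :
  {[tens n1 n2, tens n3 n4]} = tens {[n1, n2]} {[n3, n4]}.
Proof. by rewrite -pclass_lie; apply/pclassP/LC_rel; constructor. Qed.

(** No stability of [A] under brackets is asked for: a bracket of two generators is again a
    generator, so their linear span [S] is already a subalgebra, hence everything. *)
Lemma tensor_span (K : fieldType) (N : lieAlgType K)
    (A : set (tensor N)) :
  subspace A -> (forall n n', A (tens n n')) -> forall t, A t.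
Proof.
move=> subA Atens t.
pose S := smallest (@subspace K (tensor N))
  [set tens n n' | n in [set: N] & n' in [set: N]].
have subS : subspace S.
  split=> [B [[B0 _] _]|a x y Sx Sy B BP]; first exact: B0.
  by apply: BP.1.2; [exact: Sx | exact: Sy].
have Stens n n' : S (tens n n') by move=> B [_]; apply; exists n => //; exists n'.
have bb := @lie_bilinear K (tensor N).
have Slie x y : S x -> S y -> S {[x, y]}.
  (* Minimality of [S] is used twice: first to reduce [x] to a generator with [y] fixed, then to
     reduce [y]. *)
  move=> Sx Sy; apply: (Sx [set x | S {[x, y]}]); split=> [|_ [n _ [n' _ <-]]].
    split=> [|a x1 x2 /= S1 S2].
      by rewrite /= (bilinear_for0l bb); case: subS.
    by rewrite bb.1 /=; exact: subS.2.
  apply: (Sy [set y | S {[tens n n', y]}]); split=> [|_ [p _ [p' _ <-]]].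
    split=> [|a x1 x2 /= S1 S2].
      by rewrite /= (bilinear_for0r bb); case: subS.
    by rewrite bb.2 /=; exact: subS.2.
  by rewrite /= lie_tens.
have [S0 Slin] := subS.
suff St : S t by apply: St; split=> // _ [n _ [n' _ <-]].
elim/pclass_ind: t; elim=> [[n n']||s IHs u IHu|a s IHs|s IHs u IHu] //.
- exact: Stens.
- by rewrite pclassD -[pclass _ s]scale1r; exact: Slin.
- by rewrite pclassZ -[_ *: _]addr0; exact: Slin.
- by rewrite pclass_lie; exact: Slie.
Qed.

(** Both sides are bilinear in [(t, s)], and on generators this is [lie_tens]. *)
Lemma lie_tensorE (K : fieldType) (N : lieAlgType K)
    (phi : {lie tensor N -> N}) :
  (forall n n', phi (tens n n') = {[n, n']}) ->
  forall t s, {[t, s]} = tens (phi t) (phi s).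
Proof.
move=> phiE t s; have bb := @lie_bilinear K (tensor N).
have tb := @tens_bilinear K N.
apply: (@tensor_span K N [set t | {[t, s]} = tens (phi t) (phi s)]).
  split=> [|a x y /= xE yE].
    by rewrite /= linear0 (bilinear_for0l bb) (bilinear_for0l tb).
  by rewrite bb.1 /= linearP tb.1 /= xE yE.
move=> n n' /=.
apply: (@tensor_span K N
  [set s | {[tens n n', s]} = tens (phi (tens n n')) (phi s)]).
  split=> [|a x y /= xE yE].
    by rewrite /= linear0 (bilinear_for0r bb) (bilinear_for0r tb).
  by rewrite bb.2 /= linearP tb.2 /= xE yE.
by move=> p p' /=; rewrite lie_tens !phiE.
Qed.

(** The relations of [tensor_rel] read in [L]: such [b] are exactly the restrictions to generators
    of Lie homomorphisms [tensor N -> L]. *)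
Definition tensor_pairing (K : fieldType) (N L : lieAlgType K)
    (b : N -> N -> L) : Prop :=
  [/\ bilinear_for *:%R *:%R b,
      forall x y z, b {[x, y]} z = b x {[y, z]} - b y {[x, z]},
      forall x y z, b x {[y, z]} = b {[z, x]} y - b {[y, x]} z
    & forall x y z t, {[b x y, b z t]} = b {[x, y]} {[z, t]}].

Lemma tensor_pairing_hom (K : fieldType) (N L : lieAlgType K)
    (b : N -> N -> L) (bP : tensor_pairing b) :
  exists phi : {lie tensor N -> L}, forall n n', phi (tens n n') = b n n'.
Proof.
case: bP => bb bl br bbr.
have fR : respects (fun p : N * N => b p.1 p.2) (@tensor_rel K N).
  move=> _ _ [] * /=; rewrite ?scaleN1r //; [exact: bb.1|exact: bb.2].
by exists (presented_lift fR) => n n'; exact: presented_lift_pclass.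
Qed.

(** The two middle relations are braiding axioms, up to antisymmetry; the last holds because a
    bracket in [M] is the braiding of the boundaries, and the boundary of a braiding is a
    bracket. *)
Lemma braid_tensor_pairing (K : fieldType) (X : braidedCrossedModule K) :
  tensor_pairing (@braid K X).
Proof.
have bb := braid_bilinear X.
split=> // [x y z|x y z|x y z t]; first exact: braid_liel.
- by rewrite braid_lier (lieC z) (lieC y) !(bilinear_forNl bb) opprK addrC.
- by rewrite -braid_dd !xmd_braid.
Qed.

(** * Morphisms from identity modules, and central extensions *)

Lemma id_bxm_morphism (K : fieldType) (P : lieAlgType K)
    (X : braidedCrossedModule K) (h : {lie P -> xmM X}) :
  @is_bxm_morphism K (id_braidedCrossedModule P) X h (xmd X \o h).
Proof.
split=> //= [n m|n n']; first by rewrite xm_peiffer lie_morph.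
by rewrite braid_dd lie_morph.
Qed.

(** The differences [x - x'] and [y - y'] lie in the kernel of [bxm2 f], hence in [braid_center Z];
    one argument is changed at a time. *)
Lemma central_extension_braid (K : fieldType) (X Z : braidedCrossedModule K)
    (f : bxmMorphism Z X) (cf : central_extension f) (x x' y y' : xmN Z) :
  bxm2 f x = bxm2 f x' -> bxm2 f y = bxm2 f y' -> braid x y = braid x' y'.
Proof.
case: cf => _ _ cf fx fy; have bb := braid_bilinear Z.
have /cf kx : bxm2 f (x - x') = 0 by rewrite linearB /= fx subrr.
have /cf ky : bxm2 f (y - y') = 0 by rewrite linearB /= fy subrr.
transitivity (braid x' y); apply/eqP; rewrite -subr_eq0.
  by rewrite -(bilinear_forBl bb) (kx _).1.
by rewrite -(bilinear_forBr bb) (ky _).2.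
Qed.

Lemma central_extension_pairing (K : fieldType)
    (X Z : braidedCrossedModule K) (f : bxmMorphism Z X) :
  central_extension f ->
  exists2 b : xmN X -> xmN X -> xmM Z, tensor_pairing b &
    forall x y, b (bxm2 f x) (bxm2 f y) = braid x y.
Proof.
move=> cf; have [[_ sur] _ _] := cf.
(* A set-theoretic section suffices: by [bE] its choice does not affect [b], and the relations for
   [b] are pulled back along the surjection [bxm2 f] to those for [braid]. *)
have [s sK] := choice sur.
pose b x y := braid (s x) (s y).
have bE x y : b (bxm2 f x) (bxm2 f y) = braid x y.
  by apply: (central_extension_braid cf); rewrite sK.
exists b => //; have [bb bl br bbr] := braid_tensor_pairing Z.
split.
- split=> z a x y; move: (sur x) (sur y) (sur z) => [x' <-] [y' <-] [z' <-].
    by rewrite -linearP !bE bb.1.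
  by rewrite -linearP !bE bb.2.
- move=> x y z; move: (sur x) (sur y) (sur z) => [x' <-] [y' <-] [z' <-].
  by rewrite -!lie_morph !bE bl.
- move=> x y z; move: (sur x) (sur y) (sur z) => [x' <-] [y' <-] [z' <-].
  by rewrite -!lie_morph !bE br.
- move=> x y z t.
  move: (sur x) (sur y) (sur z) (sur t) => [x' <-] [y' <-] [z' <-] [t' <-].
  by rewrite -!lie_morph !bE bbr.
Qed.

(** With the minimality of [braid_subalgebra] and [derived], this turns perfectness into
    surjectivity of both components of [Phi]. *)
Lemma lie_image_subalgebra (K : fieldType) (L M : lieAlgType K)
    (f : {lie L -> M}) : lie_subalgebra (range f).
Proof.
split; first split.
- by exists 0; rewrite ?linear0.
- by move=> a _ _ [x _ <-] [y _ <-]; exists (a *: x + y); rewrite ?linearP.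
- by move=> _ _ [x _ <-] [y _ <-]; exists {[x, y]}; rewrite ?lie_morph.
Qed.

Theorem corollary2p8 (K : fieldType) (X : braidedCrossedModule K)
    (perfX : perfect X) :
  exists Phi : bxmMorphism (id_braidedCrossedModule (tensor (xmN X))) X,
    [/\ determined_by (fun n n' : xmN X => braid n n') (bxm1 Phi),
        determined_by (fun n n' : xmN X => lie n n') (bxm2 Phi)
      & universal_central_extension Phi].
Proof.
have [phi phiE] := tensor_pairing_hom (braid_tensor_pairing X).
have dphiE n n' : (xmd X \o phi) (tens n n') = {[n, n']}.
  by rewrite /= phiE xmd_braid.
have lieE := lie_tensorE dphiE.
have tb := @tens_bilinear K (xmN X).
have sur1 y : exists x, phi x = y.
  have : braid_subalgebra X y by rewrite perfX.1.
  case/(_ (range phi)) => [|x _ <-]; last by exists x.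
  split=> [|_ [n _ [n' _ <-]]]; first exact: lie_image_subalgebra.
  by exists (tens n n').
have sur2 y : exists x, (xmd X \o phi) x = y.
  have : derived (xmN X) y by rewrite perfX.2.
  case/(_ (range (xmd X \o phi))) => [|x _ <-]; last by exists x.
  split=> [|_ [n _ [n' _ <-]]]; first exact: (lie_image_subalgebra _).1.
  by exists (tens n n').
exists (BxmMorphism (id_bxm_morphism phi)); split=> /=.
- by split=> // psi psiE; apply: tensor_hom_ext => n n'; rewrite psiE phiE.
- by split=> // psi psiE; apply: tensor_hom_ext => n n'; rewrite psiE -dphiE.
split.
  (* In the identity module both action and braiding are the bracket, so by [lieE] each centrality
     condition becomes the vanishing of a tensor with a zero factor. *)
  split=> //= t /= t0 s.
    by transitivity {[s, t]}; rewrite // lieE /= t0 linear0 (bilinear_for0r tb).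
  split.
    by transitivity {[t, s]}; rewrite // lieE /= t0 (bilinear_for0l tb).
  by transitivity {[s, t]}; rewrite // lieE /= t0 (bilinear_for0r tb).
move=> Z f cf; have [b bP bE] := central_extension_pairing cf.
have [h hE] := tensor_pairing_hom bP.
have [[_ fsur] _ _] := cf.
have fh : phi =1 bxm1 f \o h.
  apply: tensor_hom_ext => n n'; rewrite phiE /= hE.
  have [x <-] := fsur n; have [y <-] := fsur n'.
  by rewrite bE (bxm_morph_braid (bxmP f)).
have fdh : xmd X \o phi =1 bxm2 f \o (xmd Z \o h).
  by move=> t /=; rewrite fh /= (bxm_morph_d (bxmP f)).
exists (BxmMorphism (id_bxm_morphism h)); split=> // h' [fh' fdh'].
have h1E : bxm1 h' =1 h.
  apply: tensor_hom_ext => n n'.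
  (* Perfectness makes the generator a bracket [{[t, s]}]. Both lifts send it to a braiding in [Z],
     and the arguments of the two braidings have equal images under [bxm2 f]. *)
  have [t <-] := sur2 n; have [s <-] := sur2 n'; rewrite -lieE.
  rewrite [RHS]lie_morph -braid_dd; transitivity (braid (bxm2 h' t) (bxm2 h' s)).
    exact: (bxm_morph_braid (bxmP h')).
  by apply: (central_extension_braid cf); rewrite -[LHS]fdh' -[RHS]fdh.
(* The boundary of the source is the identity, so the second component is the boundary of the
   first. *)
split=> // t; transitivity (xmd Z (bxm1 h' t)); last by rewrite h1E.
exact/esym/(bxm_morph_d (bxmP h')).
Qed.
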